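(* There exists an integer $K_1>0$ such that the following holds. For every $\delta\in(0,1]$ and every $\delta$-LCC configuration $V=(v_1,\ldots,v_m)\in(\mathbb{C}^d)^m$, there exists a sublist $V'$ of $V$ of size at least $\delta^3m/K_1$ and of dimension at most $K_1/\delta^6$.
   Context: A list of non-zero points $(v_1,\ldots,v_m)$ in $\mathbb{C}^d$ (not necessarily distinct) is a $\delta$-LCC configuration if for every subset $\Delta\subseteq[m]$ of size at most $\delta m$ and every $i\in[m]$ there exist $j,k\in[m]\setminus\Delta$ such that either $v_i\in\{v_j,v_k\}$, or $v_i,v_j,v_k$ are three distinct collinear points. A sublist is obtained by selecting a subset of the indices (size counts repetitions). The dimension of a list is the dimension of the smallest affine subspace containing all its points. *)

(* Defs.v *)
From mathcomp Require Import all_boot all_order all_algebra.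
From mathcomp Require Import classical_sets reals complex.

Set Implicit Arguments.
Unset Strict Implicit.
Unset Printing Implicit Defensive.

Import Order.TTheory GRing.Theory Num.Theory.
Local Open Scope classical_set_scope.
Local Open Scope ring_scope.

Definition flat (K : fieldType) (d : nat) (p : 'rV[K]_d)
    (U : {vspace 'rV[K]_d}) : set 'rV[K]_d :=
  [set x | x - p \in U].

(* The empty set counts as an affine subspace (of dimension -1), so that the
   empty list of points has a smallest affine subspace too. *)
Definition is_affine (K : fieldType) (d : nat) (S : set 'rV[K]_d) : Prop :=
  S = set0 \/ exists p U, S = flat p U.

Definition has_affine_dim (K : fieldType) (d : nat) (S : set 'rV[K]_d)
    (n : int) : Prop :=
  (S = set0 /\ n = -1) \/ exists p U, S = flat p U /\ n = (\dim U)%:Z.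

Definition affine_hull (K : fieldType) (d : nat) (X : set 'rV[K]_d) :
    set 'rV[K]_d :=
  smallest (@is_affine K d) X.

Definition collinear (K : fieldType) (d : nat) (x y z : 'rV[K]_d) : Prop :=
  exists p U, [/\ \dim U = 1%N, flat p U x, flat p U y & flat p U z].

Definition is_LCC (R : realType) (delta : R) (d m : nat)
    (V : 'I_m -> 'rV[R[i]]_d) : Prop :=
  (forall i, V i != 0) /\
  forall Delta : {set 'I_m}, #|Delta|%:R <= delta * m%:R ->
  forall i : 'I_m, exists j k : 'I_m,
    [/\ j \notin Delta, k \notin Delta &
        (V i = V j \/ V i = V k) \/
        [/\ V i != V j, V i != V k, V j != V k &
            collinear (V i) (V j) (V k)]].

(* A sublist of V is given by its set J of indices; its size is #|J|. *)
Definition has_sublist_dim (K : fieldType) (d m : nat) (V : 'I_m -> 'rV[K]_d)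
    (J : {set 'I_m}) (n : int) : Prop :=
  has_affine_dim (affine_hull [set x | exists2 i, i \in J & x = V i]) n.

(* Main.v *)
Require Import Defs.
From mathcomp Require Import all_boot all_order all_algebra.
From mathcomp Require Import classical_sets reals complex.
From mathcomp Require Import perm sequences exp ring lra zify.
(* Imported last, so that their names shadow those of classical_sets. *)
From mathcomp Require Import fintype finset.

(* If no large sublist has low dimension, then almost all of the list splits
   into disjoint independent sets of size D.  A linear map T that nearly
   minimises the product of the squared norms of the vectors of these sets
   (completed to bases), normalised by the determinant of T, puts the list of n
   vectors in approximately isotropic position: the squared cosines over all
   pairs sum to O(n^2 / D).  On the other hand three collinear points span a
   plane, so that their images contribute at least 1/2 to this sum.  The LCC
   property yields many collinear triples; to keep a pair of points from being
   counted too often, a triple is weighted by the inverse of the number of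
   points on its line.  A location of high multiplicity may dominate all its
   lines, so only points of the lowest multiplicities are used; their triples
   have total weight at least of order delta^2 n^2, whence D = O(1 / delta^2). *)

Set Implicit Arguments.
Unset Strict Implicit.
Unset Printing Implicit Defensive.

Import Order.TTheory GRing.Theory Num.Theory.
Local Open Scope ring_scope.

(** * Complex vectors and their squared norms *)

Section SquaredModulus.
Context {R : realType}.
Implicit Types (z w : R[i]).

Definition sqmod z : R := complex.Re z ^+ 2 + complex.Im z ^+ 2.

Lemma sqmodM z w : sqmod (z * w) = sqmod z * sqmod w.
Proof. by case: z w => [a b] [c e]; rewrite /sqmod /=; ring. Qed.

Lemma sqmod_ge0 z : 0 <= sqmod z.
Proof. by rewrite addr_ge0 ?sqr_ge0. Qed.

Lemma sqmod_eq0 z : (sqmod z == 0) = (z == 0).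
Proof. by case: z => a b; rewrite paddr_eq0 ?sqr_ge0 // !sqrf_eq0 eq_complex. Qed.

Lemma sqmod0 : sqmod 0 = 0.
Proof. by apply/eqP; rewrite sqmod_eq0. Qed.

Lemma sqmod1 : sqmod 1 = 1.
Proof. by rewrite /sqmod /=; ring. Qed.

Lemma sqmodN z : sqmod (- z) = sqmod z.
Proof. by case: z => a b; rewrite /sqmod /=; ring. Qed.

Lemma sqmodC z : sqmod z^*%C = sqmod z.
Proof. by case: z => a b; rewrite /sqmod /=; ring. Qed.

Lemma sqmod_real (x : R) : sqmod x%:C%C = x ^+ 2.
Proof. by rewrite /sqmod /=; ring. Qed.

Lemma sqmodD_le z w : sqmod (z + w) <= 2 * (sqmod z + sqmod w).
Proof.
case: z w => [a b] [c e]; rewrite /sqmod /= -subr_ge0.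
have -> : 2 * (a ^+ 2 + b ^+ 2 + (c ^+ 2 + e ^+ 2))
  - ((a + c) ^+ 2 + (b + e) ^+ 2) = (a - c) ^+ 2 + (b - e) ^+ 2 by ring.
by rewrite addr_ge0 ?sqr_ge0.
Qed.

(** The constant is crude; what counts is that it does not depend on [F]. *)
Lemma sqmod_sum_le (I : Type) (r : seq I) (F : I -> R[i]) :
  sqmod (\sum_(i <- r) F i) <= 2 ^+ size r * \sum_(i <- r) sqmod (F i).
Proof.
elim: r => [|i r IHr]; first by rewrite !big_nil sqmod0 mulr0.
rewrite !big_cons (le_trans (sqmodD_le _ _)) //= exprS -mulrA ler_pM2l //.
rewrite mulrDr lerD // ler_peMl ?sqmod_ge0 //.
by rewrite exprn_ege1 // ler1n.
Qed.

Lemma sqmod_prod (I : Type) (r : seq I) (F : I -> R[i]) :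
  sqmod (\prod_(i <- r) F i) = \prod_(i <- r) sqmod (F i).
Proof. by apply: (big_morph sqmod sqmodM sqmod1). Qed.

End SquaredModulus.

Section HermitianForm.
Context {R : realType} {d : nat}.
Implicit Types (x y e : 'rV[R[i]]_d).

Definition hdot x y : R[i] := \sum_j x 0 j * (y 0 j)^*%C.
Definition sqnorm x : R := \sum_j sqmod (x 0 j).

Lemma sqnorm_ge0 x : 0 <= sqnorm x.
Proof. by apply: sumr_ge0 => j _; apply: sqmod_ge0. Qed.

Lemma sqnorm_gt0 x : (0 < sqnorm x) = (x != 0).
Proof.
rewrite lt_neqAle sqnorm_ge0 andbT eq_sym psumr_eq0; last by move=> j _; apply: sqmod_ge0.
congr (~~ _); apply/allP/eqP => [x0|-> j _]; last by rewrite mxE /= sqmod0.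
by apply/rowP => j; apply/eqP; rewrite mxE -sqmod_eq0; apply: (x0 j (mem_index_enum j)).
Qed.

Lemma hdotC x y : hdot x y = (hdot y x)^*%C.
Proof.
rewrite /hdot rmorph_sum; apply: eq_bigr => j _.
by rewrite rmorphM /= conjcK mulrC.
Qed.

Lemma hdotDl x y e : hdot (x + y) e = hdot x e + hdot y e.
Proof. by rewrite /hdot -big_split; apply: eq_bigr => j _; rewrite mxE mulrDl. Qed.

Lemma hdotZl (c : R[i]) x e : hdot (c *: x) e = c * hdot x e.
Proof. by rewrite /hdot big_distrr /=; apply: eq_bigr => j _; rewrite mxE mulrA. Qed.

Lemma hdotxx x : hdot x x = (sqnorm x)%:C%C.
Proof.
rewrite /sqnorm rmorph_sum; apply: eq_bigr => j _.
by case: (x 0 j) => a b; apply/eqP; rewrite eq_complex /=; apply/andP; split;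
  apply/eqP; rewrite /sqmod /=; ring.
Qed.

(** For [c] the inverse of [sqnorm e] this is Pythagoras. It is used with half that value, where the
    bracket becomes 3/4 of the inverse of [sqnorm e]. *)
Lemma sqnorm_sub_proj x e (c : R) :
  sqnorm (x - (c%:C%C * hdot x e) *: e) =
  sqnorm x - (2 * c - c ^+ 2 * sqnorm e) * sqmod (hdot x e).
Proof.
set z := c%:C%C * _.
have pw (a b : R[i]) : sqmod (a - z * b) =
    sqmod a - 2 * complex.Re (a * b^*%C * z^*%C) + sqmod z * sqmod b.
  by case: a b z => [? ?] [? ?] [? ?]; rewrite /sqmod /=; ring.
rewrite {1}/sqnorm; under eq_bigr do rewrite !mxE pw.
rewrite big_split sumrB /= -!mulr_sumr -/(sqnorm x) -/(sqnorm e).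
rewrite -(raddf_sum (@complex.Re R)) -mulr_suml -/(hdot x e) sqmodM sqmod_real.
rewrite /z; case: (hdot x e) => a b; rewrite /sqmod /=; ring.
Qed.

End HermitianForm.

(** * Radial isotropic position *)

Section RadialIsotropy.
Context {R : realType} {d : nat}.

(** Factor one bordered matrix in two ways into block triangular matrices and compare
    determinants. *)
Lemma det_1B_rank1 (F : comUnitRingType) n (u : 'cV[F]_n) (v : 'rV[F]_n) :
  \det (1%:M - u *m v) = 1 - (v *m u) 0 0.
Proof.
have e1 : block_mx 1%:M u v 1%:M =
    block_mx 1%:M 0 v 1%:M *m block_mx 1%:M u 0 (1%:M - v *m u).
  by rewrite mulmx_block ?(mulmx1, mul1mx, mul0mx, mulmx0) !addr0 addrC subrK.
have e2 : block_mx 1%:M u v 1%:M =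
    block_mx (1%:M - u *m v) u 0 1%:M *m block_mx 1%:M 0 v 1%:M.
  by rewrite mulmx_block ?(mulmx1, mul1mx, mul0mx, mulmx0) !add0r subrK.
have := congr1 determinant e1; rewrite e2 !det_mulmx !det_ublock !det_lblock.
by rewrite !det1 !mul1r !mulr1 det_mx11 !mxE.
Qed.

(** Hadamard's inequality up to a constant: each term of the Leibniz expansion is bounded by the
    product of the row norms. Any positive [c] serves, since it only keeps an infimum away from
    0. *)
Lemma hadamard_weak : exists2 c : R, 0 < c &
  forall A : 'M[R[i]]_d, c * sqmod (\det A) <= \prod_r sqnorm (row r A).
Proof.
pose s := index_enum {perm 'I_d}.
pose M : R := 2 ^+ size s * (size s)%:R + 1.
have M_gt0 : 0 < M by rewrite ltr_wpDl // mulr_ge0 ?exprn_ge0.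
exists M^-1 => [|A]; first by rewrite invr_gt0.
rewrite mulrC ler_pdivrMr // (le_trans (sqmod_sum_le _ _)) //.
have P_ge0 : 0 <= \prod_r sqnorm (row r A).
  by apply: prodr_ge0 => r _; apply: sqnorm_ge0.
rewrite mulrDr mulr1 ler_wpDr // mulrCA ler_wpM2l ?exprn_ge0 //.
apply: le_trans (_ : \sum_(t <- s) \prod_r sqnorm (row r A) <= _).
  apply: ler_sum => t _; rewrite sqmodM sqmod_prod.
  have -> : sqmod ((-1) ^+ t : R[i]) = 1.
    by case: (odd_perm t); rewrite ?expr1 ?sqmodN ?expr0 sqmod1.
  rewrite mul1r; apply: ler_prod => r _; rewrite sqmod_ge0 /=.
  rewrite /sqnorm (bigD1 (t r)) //= mxE lerDl.
  by apply: sumr_ge0 => j _; apply: sqmod_ge0.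
by rewrite big_const_seq count_predT iter_addr_0 mulr_natr.
Qed.

(** Acting on row vectors from the right, this halves the component along [e] and fixes the
    orthogonal complement. For [e = 0] it is the identity, as the inverse of 0 is 0. *)
Definition squeeze (e : 'rV[R[i]]_d) : 'M[R[i]]_d :=
  1%:M - (2 * sqnorm e)^-1%:C%C *: ((map_mx conjc e)^T *m e).

Lemma mul_squeeze (x e : 'rV[R[i]]_d) :
  x *m squeeze e = x - ((2 * sqnorm e)^-1%:C%C * hdot x e) *: e.
Proof.
rewrite /squeeze mulmxBr mulmx1 -scalemxAr mulmxA -scalerA.
congr (_ - _ *: _).
have -> : x *m (map_mx conjc e)^T = (hdot x e)%:M.
  by apply/rowP => j; rewrite !ord1 !mxE; apply: eq_bigr => k _; rewrite !mxE.
by rewrite mul_scalar_mx.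
Qed.

Lemma det_squeeze e : e != 0 -> sqmod (\det (squeeze e)) = 1 / 4.
Proof.
move=> e0; have n0 : sqnorm e != 0 by rewrite gt_eqF // sqnorm_gt0.
rewrite /squeeze scalemxAl det_1B_rank1 -scalemxAr mxE.
have -> : (e *m (map_mx conjc e)^T) 0 0 = hdot e e.
  by rewrite !mxE; apply: eq_bigr => k _; rewrite !mxE.
rewrite hdotxx -rmorphM /=.
have -> : (2 * sqnorm e)^-1 * sqnorm e = 1 / 2 :> R by field.
rewrite -(rmorph1 (real_complex R)) -rmorphB /= sqmod_real.
by field.
Qed.

Definition cos2 (x y : 'rV[R[i]]_d) : R :=
  sqmod (hdot x y) / (sqnorm x * sqnorm y).

Lemma sqnorm_squeeze (x e : 'rV[R[i]]_d) : x != 0 -> e != 0 ->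
  sqnorm (x *m squeeze e) =
  sqnorm x * (1 - 3 / 4 * cos2 x e).
Proof.
move=> x0 e0; rewrite mul_squeeze sqnorm_sub_proj /cos2.
have nx : sqnorm x != 0 by rewrite gt_eqF // sqnorm_gt0.
have ne : sqnorm e != 0 by rewrite gt_eqF // sqnorm_gt0.
by field; rewrite nx ne.
Qed.

(** Let [T] nearly minimise [F]. If the sum exceeded its bound for some [e], squeezing along [e]
    would multiply [F] by at most [theta ^+ #|K|], hence push it below its infimum. A near-minimiser
    suffices, so no compactness argument is required. *)
Lemma isotropic_position (K : finType) (B : K -> 'M[R[i]]_d) :
  (forall k, B k \in unitmx) ->
  exists2 T : 'M[R[i]]_d, T \in unitmx & forall e,
    \sum_k \sum_r cos2 (row r (B k) *m T) e <= 4 * #|K|%:R.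
Proof.
move=> Bu; have [c c0 cH] := hadamard_weak.
pose F T := \prod_k (\prod_r sqnorm (row r (B k) *m T) / sqmod (\det T)).
pose E : set R := (fun x => exists2 T, T \in unitmx & x = F T).
pose b := \prod_k (c * sqmod (\det (B k))).
have detu (A : 'M[R[i]]_d) : A \in unitmx -> 0 < sqmod (\det A).
  by rewrite unitmxE unitfE => A0; rewrite lt_neqAle eq_sym sqmod_eq0 A0 sqmod_ge0.
have b0 : 0 < b by apply: prodr_gt0 => k _; rewrite mulr_gt0 ?detu.
have bF T : T \in unitmx -> b <= F T.
  move=> Tu; apply: ler_prod => k _; rewrite mulr_ge0 ?sqmod_ge0 ?(ltW c0) //=.
  rewrite ler_pdivlMr ?detu // -mulrA -sqmodM -det_mulmx.
  apply: le_trans (cH _) _; rewrite le_eqVlt; apply/orP; left; apply/eqP.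
  by apply: eq_bigr => r _; rewrite row_mul.
have E1 : nonempty E by exists (F 1%:M); exists 1%:M; rewrite ?unitmx1.
have Eb : lbound E b by move=> _ [T Tu ->]; apply: bF.
have infb : b <= inf E by apply: lb_le_inf.
have infE : has_inf E by split=> //; exists b.
(* Nonemptiness of [K] is needed later for [theta ^+ #|K| <= theta]. *)
have [K0|K0] := eqVneq #|K| 0%N.
  exists 1%:M => [|e]; first exact: unitmx1.
  rewrite big_pred0 ?K0 ?mulr0 // => k.
  by have := card0_eq K0 k; rewrite inE.
(* The 4 is the inverse of the squared determinant of a squeeze. The exponent is 3/4 times the bound
   4 per basis. The value is below 1 because the exponential of 3 exceeds 1 + 3. *)
pose theta : R := 4 * expR (- 3).
have th0 : 0 < theta by rewrite mulr_gt0 ?expR_gt0.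
have th1 : theta < 1.
  rewrite /theta expRN ltr_pdivrMr ?expR_gt0 // mul1r.
  have /expR_gt1Dx : (3 : R) != 0 by rewrite pnatr_eq0.
  by apply: le_lt_trans; lra.
(* Adding this amount to [inf E] gives [inf E / theta], so a gain by the factor [theta] beats the
   infimum. *)
have eps0 : 0 < inf E * (theta^-1 - 1).
  apply: mulr_gt0; first exact: lt_le_trans infb.
  by rewrite subr_gt0 invf_gt1.
have [_ [T Tu ->] FT] := inf_adherent eps0 infE.
exists T => // e; have [->|e0] := eqVneq e 0.
  have h0 x : hdot x 0 = 0 :> R[i].
    by rewrite /hdot big1 // => j _; rewrite mxE conjc0 mulr0.
  under eq_bigr do under eq_bigr do rewrite /cos2 h0 sqmod0 mul0r.
  rewrite big1 => [|k _]; last by rewrite big1.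
  by rewrite mulr_ge0.
rewrite leNgt; apply/negP => big.
have Su : squeeze e \in unitmx.
  by rewrite unitmxE unitfE -sqmod_eq0 det_squeeze // mul1r invr_eq0 pnatr_eq0.
have TSu : T *m squeeze e \in unitmx by rewrite unitmx_mul Tu.
have row0 k r : row r (B k) *m T != 0.
  rewrite -row_mul; apply/eqP => r0.
  have : B k *m T \in unitmx by rewrite unitmx_mul Bu Tu.
  move=> /mulmxV/(congr1 (row r)); rewrite row_mul r0 mul0mx => /rowP/(_ r).
  by rewrite !mxE eqxx => /esym/eqP; rewrite oner_eq0.
have : F (T *m squeeze e) < inf E.
  apply: le_lt_trans (_ : F T * theta < _); last first.
    rewrite -ltr_pdivlMr //; apply: lt_le_trans FT _; lra.
  have -> : F (T *m squeeze e) = F T * \prod_k (4 *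
     \prod_r (1 - 3 / 4 * cos2 (row r (B k) *m T) e)).
    rewrite -big_split; apply: eq_bigr => k _ /=.
    under eq_bigr do rewrite mulmxA sqnorm_squeeze //.
    rewrite big_split det_mulmx sqmodM det_squeeze //=.
    have := lt0r_neq0 (detu _ Tu); move: (\prod_r _) (\prod_r _) (sqmod _).
    by move=> x y z z0; field.
  rewrite ler_wpM2l //; first by rewrite (le_trans _ (bF _ Tu)) // ltW.
  rewrite big_split prodr_const /= -[X in _ <= X]expr1.
  apply: le_trans (_ : theta ^+ #|K| <= _); last first.
    by rewrite ler_wiXn2l ?ltW // lt0n.
  rewrite exprMn ler_wpM2l ?exprn_ge0 // -expRM_natl.
  apply: le_trans (_ : \prod_k \prod_r
     expR (- (3 / 4 * cos2 (row r (B k) *m T) e)) <= _).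
    have pos k r : 0 <= 1 - 3 / 4 * cos2 (row r (B k) *m T) e.
      rewrite -(pmulr_rge0 _ (_ : 0 < sqnorm (row r (B k) *m T))) ?sqnorm_gt0 //.
      by rewrite -sqnorm_squeeze // sqnorm_ge0.
    apply: ler_prod => k _; rewrite prodr_ge0 //=.
    by apply: ler_prod => r _; rewrite pos expR_ge1Dx.
  under eq_bigr do rewrite -expR_sum.
  rewrite -expR_sum ler_expR.
  under eq_bigr do rewrite sumrN -mulr_sumr.
  by rewrite sumrN -mulr_sumr mulrN lerN2; lra.
by apply/negP; rewrite -leNgt; apply: ge_inf; [exists b|exists (T *m squeeze e)].
Qed.

End RadialIsotropy.

(** * Weighted collinear triples *)

Section CollinearTriples.
Context {K : fieldType} {vT : vectType K} {I : finType}.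
Variables (V : I -> vT) (C : {set I}).
Implicit Types a b c : I.

(** Indices are counted with multiplicity. If [V a = V b], the direction is 0 and only the copies of
    that point remain. *)
Definition line a b : {set I} := [set c in C | V c - V a \in <[V b - V a]>%VS].

Lemma line_sym a b : line a b = line b a.
Proof.
suff sub a' b' : line a' b' \subset line b' a' by apply/eqP; rewrite eqEsubset !sub.
apply/subsetP => c; rewrite !inE => /andP[-> /vlineP[k Ek]] /=.
apply/vlineP; exists (1 - k); rewrite scalerBl scale1r -scalerN opprB -Ek.
by rewrite [RHS]addrC addrA subrK.
Qed.

Lemma line_eq a b c : c \in line a b -> V c != V a -> line a c = line a b.
Proof.
rewrite inE => /andP[_ /vlineP[k Ek]] ca.
have k0 : k != 0.
  by apply: contraNneq ca => k0; rewrite -subr_eq0 Ek k0 scale0r.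
suff El : (<[V c - V a]> = <[V b - V a]>)%VS by rewrite /line El.
rewrite Ek; apply/eqP; rewrite eqEsubv -!memvE memvZ ?memv_line //=.
by apply/vlineP; exists k^-1; rewrite scalerA mulVf // scale1r.
Qed.

Definition same a : {set I} := [set c in C | V c == V a].

Definition triple a b c : bool :=
  [&& a \in C, b \in C, V a != V b, V a != V c, V b != V c & c \in line a b].

Lemma line_left a b : a \in C -> a \in line a b.
Proof. by move=> aC; rewrite inE aC subrr mem0v. Qed.

Lemma line_right a b : b \in C -> b \in line a b.
Proof. by move=> bC; rewrite inE bC memv_line. Qed.

Lemma tripleC a b c : triple a b c = triple b a c.
Proof.
rewrite /triple line_sym [V a == V b]eq_sym.
by case: (a \in C); case: (b \in C); case: (V b == V a); case: (V a == V c);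
  case: (V b == V c).
Qed.

Lemma triple_line a b c : triple a b c -> line a c = line a b.
Proof. by case/and5P=> _ _ _ ac /andP[_]; move/line_eq; apply; rewrite eq_sym. Qed.

Lemma tripleA a b c : triple a b c = triple a c b.
Proof.
suff sub b' c' : triple a b' c' -> triple a c' b' by apply/idP/idP; apply: sub.
move=> t; have L := triple_line t.
case/and5P: t => aC bC ab ac /andP[bc cL].
rewrite /triple aC ab ac [_ == V b']eq_sym bc L line_right // andbT /=.
by move: cL; rewrite inE andbT => /andP[].
Qed.

Section Energy.
Context {R : realFieldType}.
Variable g : I -> I -> R.
Hypothesis g_ge0 : forall a b, 0 <= g a b.

(* Weighting a triple by the inverse size of its line makes the weights
   through a given pair sum to at most 1. *)
Definition lweight a b : R := #|line a b|%:R^-1.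

Lemma pair_energy_le :
  \sum_a \sum_b \sum_(c | triple a b c) lweight a b * g a b <=
  \sum_(a in C) \sum_(b in C) g a b.
Proof.
have inner a b : \sum_(c | triple a b c) lweight a b * g a b <=
    (if (a \in C) && (b \in C) then g a b else 0).
  case: ifP => [/andP[aC bC]|abC]; last first.
    rewrite big_pred0 // => c; rewrite /triple.
    by move: abC; case: (a \in C) => //= ->.
  rewrite sumr_const -mulr_natl mulrA ler_piMl //.
  have L0 : 0 < #|line a b|%:R :> R.
    by rewrite ltr0n; apply/card_gt0P; exists a; apply: line_left.
  rewrite ler_pdivrMr // mul1r ler_nat subset_leq_card //.
  by apply/subsetP => c /and5P[_ _ _ _ /andP[]].
rewrite [X in _ <= X]big_mkcond; apply: ler_sum => a _ /=.
apply: le_trans (ler_sum _ (fun b _ => inner a b)) _.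
case: (a \in C) => /=; last by rewrite big1.
by rewrite [X in _ <= X]big_mkcond.
Qed.

(** Both [triple] and the weight are invariant under permuting the three indices, so each of the
    three pairs contributes at most one pair energy after reindexing. *)
Lemma triple_energy_le :
  \sum_a \sum_b \sum_(c | triple a b c) lweight a b * (g a b + g a c + g b c)
  <= 3 * \sum_(a in C) \sum_(b in C) g a b.
Proof.
set E := (X in 3 * X).
pose F a b c := if triple a b c then lweight a b * g a b else 0.
have FE : \sum_a \sum_b \sum_c F a b c <= E.
  apply: le_trans pair_energy_le; apply: ler_sum => a _; apply: ler_sum => b _.
  by rewrite -big_mkcond.
have -> : 3 * E = E + E + E by ring.
have -> : \sum_a \sum_b \sum_(c | triple a b c)
    lweight a b * (g a b + g a c + g b c) =
    \sum_a \sum_b \sum_c F a b c + \sum_a \sum_b \sum_c F a c b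
    + \sum_a \sum_b \sum_c F b c a.
  rewrite -!big_split; apply: eq_bigr => a _.
  rewrite -!big_split; apply: eq_bigr => b _.
  rewrite -!big_split big_mkcond; apply: eq_bigr => c _ /=.
  have tb : triple b a c = triple a b c by rewrite tripleC.
  rewrite /F -[triple a c b]tripleA -[triple b c a]tripleA tb.
  case: ifP => t; last by rewrite !addr0.
  rewrite t in tb.
  by rewrite /lweight (triple_line t) (triple_line tb) (line_sym b a) !mulrDr.
rewrite !lerD //.
  rewrite (le_trans _ FE) //; apply: ler_sum => a _.
  by rewrite exchange_big.
rewrite (le_trans _ FE) // exchange_big /=; apply: ler_sum => b _.
by rewrite exchange_big.
Qed.

End Energy.

(** * Lower bounds for the weight of the triples through one point *)

Definition thirds a b : {set I} := [set c | triple a b c].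

(** The factor 4 ensures that the triples over such a pair have total weight at least 1/4. *)
Definition rich a : {set I} :=
  [set b in C | (V b != V a) && (#|line a b| <= 4 * #|thirds a b|)%N].
Definition dominated a : {set I} :=
  [set b in C | (V b != V a) && (#|line a b| < 2 * #|same a|)%N].
Definition lighter a : {set I} := [set b in C | (#|same b| < #|same a|)%N].

(** The copies of [a] and of [b] are disjoint parts of the line. If the former fill more than half
    of it, the latter fill less than half. *)
Lemma dominated_lighter a : a \in C -> dominated a \subset lighter a.
Proof.
move=> aC; apply/subsetP => b; rewrite !inE => /and3P[-> ba L] /=.
have : (#|same a :|: same b| <= #|line a b|)%N.
  apply/subset_leq_card/subsetP => c; rewrite !inE -andb_orr.
  case/andP=> -> /orP[] /eqP -> /=; first by rewrite subrr mem0v.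
  exact: memv_line.
rewrite cardsU (_ : same a :&: same b = set0) ?cards0; first lia.
apply/setP => c; rewrite !inE; apply/negP => /andP[/andP[_ /eqP e1] /andP[_ /eqP e2]].
by move: ba; rewrite -e1 e2 eqxx.
Qed.

Lemma line_card a b : a \in C -> b \in C -> V a != V b ->
  (#|line a b| <= #|same a| + #|same b| + #|thirds a b|)%N.
Proof.
move=> aC bC ab; apply: leq_trans (leq_add (leq_card_setU _ _) (leqnn _)).
apply: leq_trans (leq_card_setU _ _).
apply/subset_leq_card/subsetP => c cL; rewrite !inE /triple aC bC ab cL.
move: cL; rewrite inE => /andP[-> _] /=; rewrite [V a == _]eq_sym [V b == _]eq_sym.
by case: (V c == V a); case: (V c == V b).
Qed.

Lemma same_thirds a b c : triple a b c -> same c \subset thirds a b.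
Proof.
case/and5P=> aC bC ab ac /andP[bc]; rewrite inE => /andP[cC cL].
apply/subsetP => e; rewrite !inE => /andP[eC /eqP e_c].
by rewrite /triple aC bC ab e_c ac bc inE eC e_c.
Qed.

(** If [b] is not rich, the third points, among them all copies of [c], make up less than a quarter
    of the line. Copies of [a] take at most half, so more than a quarter is left as third points for
    the pair [a], [c]. *)
Lemma rich_cover a b c : triple a b c ->
  (2 * #|same a| <= #|line a b|)%N -> (b \in rich a) || (c \in rich a).
Proof.
move=> t L2; have t' : triple a c b by rewrite -tripleA.
have L := triple_line t; have := subset_leq_card (same_thirds t).
have cC : c \in C by case/and5P: t => _ _ _ _ /andP[_]; rewrite inE => /andP[].
move: (t); case/and5P=> aC bC ab ac _.
have := line_card aC cC ac.
rewrite !inE bC cC [V b == _]eq_sym [V c == _]eq_sym ab ac L /=.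
by case: leqP => //= L3 L4 L5; lia.
Qed.

Lemma rich_weight_ge (R : realFieldType) a : a \in C ->
  #|rich a|%:R / 4 <= \sum_b \sum_(c | triple a b c) lweight a b :> R.
Proof.
move=> aC; have -> : #|rich a|%:R / 4 = \sum_(b in rich a) 4^-1 :> R.
  by rewrite sumr_const mulr_natl.
rewrite big_mkcond; apply: ler_sum => b _.
have w0 : 0 <= lweight a b :> R by rewrite invr_ge0.
case: ifP => bR; last by rewrite sumr_ge0.
have L0 : 0 < #|line a b|%:R :> R.
  by rewrite ltr0n; apply/card_gt0P; exists a; apply: line_left.
have -> : \sum_(c | triple a b c) lweight a b = #|thirds a b|%:R / #|line a b|%:R :> R.
  rewrite sumr_const mulr_natl; congr (_ *+ _).
  by apply: eq_card => c; rewrite /thirds in_set.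
rewrite ler_pdivlMr //; move: bR; rewrite in_set => /and3P[_ _].
by rewrite -(ler_nat R) natrM => L; lra.
Qed.

(** Otherwise delete the copies of [a], the dominated and the rich indices. The first deletion
    excludes coincidences, and a surviving triple would contradict [rich_cover]. *)
Lemma rich_large (R : realFieldType) a (s : R) : a \in C ->
  (forall D : {set I}, #|D|%:R <= s -> exists b c,
     [/\ b \in C, c \in C, b \notin D, c \notin D &
         (V a = V b \/ V a = V c) \/ triple a b c]) ->
  s < (#|same a| + #|lighter a| + #|rich a|)%:R.
Proof.
move=> aC H; rewrite ltNge; apply/negP => le_s.
have [|b [c [bC cC]]] := H (same a :|: dominated a :|: rich a).
  apply: le_trans le_s; rewrite ler_nat; apply: leq_trans (leq_card_setU _ _) _.
  rewrite leq_add2r (leq_trans (leq_card_setU _ _)) // leq_add2l.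
  exact: subset_leq_card (dominated_lighter aC).
rewrite !in_setU !negb_or => /andP[/andP[bs bd] br] /andP[/andP[cs cd] cr].
case=> [[] e|t]; first by move: bs; rewrite inE bC e eqxx.
  by move: cs; rewrite inE cC e eqxx.
have L2 : (2 * #|same a| <= #|line a b|)%N.
  move: bd bs; rewrite [b \in dominated a]inE [b \in same a]inE bC /=.
  by case: (V b == V a) => //=; rewrite -leqNgt.
by have := rich_cover t L2; rewrite (negbTE br) (negbTE cr).
Qed.

End CollinearTriples.

(** * Independent sets and affine hulls *)

Section Cos2.
Context {R : realType} {d : nat}.
Implicit Types x y z : 'rV[R[i]]_d.

Lemma cos2_ge0 x y : 0 <= cos2 x y.
Proof. by rewrite divr_ge0 ?sqmod_ge0 // mulr_ge0 ?sqnorm_ge0. Qed.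

Lemma cos2C x y : cos2 x y = cos2 y x.
Proof. by rewrite /cos2 hdotC sqmodC [sqnorm y * _]mulrC. Qed.

(** Pair the relation with [x], the vector of the longest term, and take squared moduli. The two
    other terms are bounded using [sqmodD_le] and the maximality of [a *: x]. *)
Lemma cos2_dependent_max x y z (a b c : R[i]) :
  x != 0 -> y != 0 -> z != 0 -> a *: x + b *: y + c *: z = 0 -> a != 0 ->
  sqmod b * sqnorm y <= sqmod a * sqnorm x ->
  sqmod c * sqnorm z <= sqmod a * sqnorm x ->
  1 / 2 <= cos2 x y + cos2 x z.
Proof.
move=> x0 y0 z0 lin a0 leb lec.
have X0 : 0 < sqnorm x by rewrite sqnorm_gt0.
have Y0 : 0 < sqnorm y by rewrite sqnorm_gt0.
have Z0 : 0 < sqnorm z by rewrite sqnorm_gt0.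
have A0 : 0 < sqmod a by rewrite lt_neqAle eq_sym sqmod_eq0 a0 sqmod_ge0.
have e : a * (sqnorm x)%:C%C = - (b * hdot y x + c * hdot z x).
  apply/eqP; rewrite -addr_eq0 -hdotxx -!hdotZl -!hdotDl addrA lin.
  by rewrite /hdot big1 // => j _; rewrite mxE mul0r.
have ey : sqmod (hdot y x) = cos2 x y * (sqnorm x * sqnorm y).
  by rewrite /cos2 hdotC sqmodC divfK // gt_eqF // mulr_gt0.
have ez : sqmod (hdot z x) = cos2 x z * (sqnorm x * sqnorm z).
  by rewrite /cos2 hdotC sqmodC divfK // gt_eqF // mulr_gt0.
have := congr1 sqmod e; rewrite sqmodN sqmodM sqmod_real => e1.
have := sqmodD_le (b * hdot y x) (c * hdot z x).
rewrite -e1 !sqmodM ey ez.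
have p0 := cos2_ge0 x y; have q0 := cos2_ge0 x z.
have : cos2 x y * sqnorm x * (sqmod b * sqnorm y) <=
       cos2 x y * sqnorm x * (sqmod a * sqnorm x).
  by rewrite ler_wpM2l // mulr_ge0 // ltW.
have : cos2 x z * sqnorm x * (sqmod c * sqnorm z) <=
       cos2 x z * sqnorm x * (sqmod a * sqnorm x).
  by rewrite ler_wpM2l // mulr_ge0 // ltW.
move: (cos2 x y) (cos2 x z) (sqnorm x) (sqnorm y) (sqnorm z) (sqmod a)
  (sqmod b) (sqmod c) X0 A0 {leb lec e e1 ey ez p0 q0 Y0 Z0}
  => p q X Y Z A B C X0 A0 h1 h2 h3.
have : A * X ^+ 2 * 1 <= A * X ^+ 2 * (2 * (p + q)) by lra.
rewrite ler_pM2l ?mulr_gt0 ?exprn_gt0 // => h; lra.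
Qed.

(** Put the longest of the three terms first; its coefficient is non-zero because some coefficient
    is. *)
Lemma cos2_dependent x y z (a b c : R[i]) :
  x != 0 -> y != 0 -> z != 0 -> a *: x + b *: y + c *: z = 0 ->
  ~~ [&& a == 0, b == 0 & c == 0] ->
  1 / 2 <= cos2 x y + cos2 x z + cos2 y z.
Proof.
move=> x0 y0 z0 lin abc.
have pos (k : R[i]) (v : 'rV[R[i]]_d) : v != 0 -> (0 < sqmod k * sqnorm v) = (k != 0).
  by move=> v0; rewrite pmulr_lgt0 ?sqnorm_gt0 // lt_neqAle eq_sym sqmod_eq0
    sqmod_ge0 andbT.
have nn (k : R[i]) (v : 'rV[R[i]]_d) : 0 <= sqmod k * sqnorm v.
  by rewrite mulr_ge0 ?sqmod_ge0 ?sqnorm_ge0.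
have xy := cos2_ge0 x y; have xz := cos2_ge0 x z; have yz := cos2_ge0 y z.
pose A := sqmod a * sqnorm x; pose B := sqmod b * sqnorm y.
pose C := sqmod c * sqnorm z.
have ABC : [|| 0 < A, 0 < B | 0 < C].
  by move: abc; rewrite !negb_and -(pos a x) // -(pos b y) // -(pos c z).
have [[BA CA]|[[AB CB]|[AC BC]]] :
    (B <= A /\ C <= A) \/ (A <= B /\ C <= B) \/ (A <= C /\ B <= C).
  have [BA|/ltW AB] := leP B A.
    have [CA|/ltW AC] := leP C A; first by left.
    by right; right; rewrite AC (le_trans BA AC).
  have [CB|/ltW BC] := leP C B; first by right; left.
  by right; right; rewrite BC (le_trans AB BC).
- have a0 : a != 0 by rewrite -(pos a x) //; rewrite -/A; case/or3P: ABC; lra.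
  have := cos2_dependent_max x0 y0 z0 lin a0 BA CA; lra.
- have b0 : b != 0 by rewrite -(pos b y) //; rewrite -/B; case/or3P: ABC; lra.
  have lin' : b *: y + a *: x + c *: z = 0 by rewrite -lin [b *: y + _]addrC.
  have := cos2_dependent_max y0 x0 z0 lin' b0 AB CB; rewrite (cos2C y x); lra.
- have c0 : c != 0 by rewrite -(pos c z) //; rewrite -/C; case/or3P: ABC; lra.
  have lin' : c *: z + a *: x + b *: y = 0 by rewrite -lin -addrA addrC.
  have := cos2_dependent_max z0 x0 y0 lin' c0 AC BC.
  by rewrite (cos2C z x) (cos2C z y); lra.
Qed.

End Cos2.

Section FreeFamilies.

Lemma free_extend_unitmx (K : fieldType) d (s : seq 'rV[K]_d) : free s ->
  exists2 B : 'M[K]_d, B \in unitmx &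
  exists t, [seq row r B | r <- enum 'I_d] = s ++ t.
Proof.
move=> free_s; pose t : seq 'rV[K]_d := vbasis (<<s>>^C).
have b : basis_of (<<s>> + <<s>>^C) (s ++ t).
  apply: cat_basis; first by apply/directv_addP/capv_compl.
    by rewrite /basis_of eqxx.
  exact: vbasisP.
have free_st := basis_free b.
have sz : size (s ++ t) == d.
  have := size_basis (X := in_tuple (s ++ t)) b.
  rewrite addv_complf dimvf.
  by rewrite [dim _]mul1n => /esym/eqP.
pose X := Tuple sz; pose B : 'M[K]_d := \matrix_r X`_r.
exists B; last first.
  exists t; rewrite -[RHS]/(tval X) -[RHS]map_tnth_enum.
  apply: eq_map => r; rewrite rowK (tnth_nth 0) //.
rewrite -row_free_unit; apply: inj_row_free => v vB.
apply/rowP => r; rewrite mxE; move: r.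
apply: (elimT (@freeP _ _ _ X) free_st (fun r => v 0 r)).
rewrite -[RHS]vB; apply/rowP => j; rewrite summxE !mxE.
by apply: eq_bigr => r _; rewrite !mxE.
Qed.

Context {K : fieldType} {d : nat} {I : finType} (V : I -> 'rV[K]_d).

Definition pts (A : {set I}) : seq 'rV[K]_d := [seq V i | i <- enum A].

Lemma exists_free_subset (J : {set I}) D : (D <= \dim <<pts J>>)%N ->
  exists A : {set I}, [/\ A \subset J, #|A| = D & free (pts A)].
Proof.
elim: D => [|D IHD] DJ.
  exists set0; rewrite sub0set cards0 /pts enum_set0; split=> //.
  exact: nil_free.
have [A [AJ cA fA]] := IHD (ltnW DJ).
have /subvPn[v vJ vA] : ~~ (<<pts J>> <= <<pts A>>)%VS.
  apply: contraL DJ => /dimvS le; rewrite -ltnNge ltnS (leq_trans le) //.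
  by rewrite (leq_trans (dim_span _)) // size_map -cardE cA.
have /existsP[j /andP[jJ jA]] : [exists j in J, V j \notin <<pts A>>%VS].
  apply: contraR vA; rewrite negb_exists => /forallP h.
  have: (<<pts J>> <= <<pts A>>)%VS; last by move/subvP/(_ v vJ).
  apply/span_subvP => _ /mapP[j jJ ->]; move: (h j).
  by rewrite mem_enum in jJ; rewrite jJ negbK.
have jNA : j \notin A.
  by apply: contra jA => jA; apply/memv_span/map_f; rewrite mem_enum.
exists (j |: A); split; first by rewrite subUset sub1set jJ.
  by rewrite cardsU1 jNA cA.
rewrite (perm_free (_ : perm_eq _ (V j :: pts A))) ?free_cons ?jA //.
apply: (perm_map V (t := j :: enum A)); apply: uniq_perm; rewrite ?enum_uniq //=.
  by rewrite mem_enum jNA enum_uniq.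
by move=> i; rewrite inE !mem_enum !inE.
Qed.

(** Take a maximal disjoint family: if the uncovered points spanned dimension [D], a further
    independent set could be added. *)
Lemma exists_free_packing D : (0 < D)%N ->
  exists P : {set {set I}}, [/\ trivIset P,
    {in P, forall A : {set I}, #|A| = D /\ free (pts A)} &
    (\dim <<pts (~: cover P)>> < D)%N].
Proof.
move=> D0; pose Q (P : {set {set I}}) :=
  trivIset P && [forall (A | A \in P), (#|A| == D) && free (pts A)].
have Q0 : Q set0.
  apply/andP; split; first by apply/trivIsetP => A B; rewrite inE.
  by apply/forall_inP => A; rewrite inE.
have [P /maxsetP[/andP[tP /forall_inP fP] maxP]] := ex_maxset (ex_intro Q _ Q0).
exists P; split=> // [A /fP /andP[/eqP]//|].
rewrite ltnNge; apply/negP => /exists_free_subset[A [AJ cA fA]].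
have A_dis B : B \in P -> [disjoint A & B].
  move=> BP; rewrite disjoint_sym disjoints_subset.
  have : B \subset cover P by apply: bigcup_sup BP.
  by move/subset_trans; apply; rewrite subsetC.
(* This is where [0 < D] enters: without empty members, a set disjoint from all members is a new
   one. *)
have P0 : set0 \notin P.
  by apply/negP => /fP /andP[]; rewrite cards0 => /eqP D_0; rewrite -D_0 in D0.
have [tAP AP] := trivIsetU1 A_dis tP P0.
case/negP: AP; rewrite -(maxP (A |: P)) ?subsetUr ?setU11 //.
rewrite /Q tAP; apply/forall_inP => B; rewrite in_setU1.
by case/predU1P => [->|/fP//]; rewrite cA eqxx.
Qed.

End FreeFamilies.

(** Complete each independent set to a basis, apply [isotropic_position], and drop the non-negative
    terms of the added vectors. *)
Lemma packing_position (R : realType) d (I : finType) (V : I -> 'rV[R[i]]_d)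
    (P : {set {set I}}) : {in P, forall A : {set I}, free (pts V A)} ->
  exists2 T : 'M[R[i]]_d, T \in unitmx &
  forall e, \sum_(A in P) \sum_(i in A) cos2 (V i *m T) e <= 4 * #|P|%:R.
Proof.
move=> fP.
have ext k : exists B : 'M[R[i]]_d, (B \in unitmx) &&
    prefix (pts V (enum_val (A := P) k)) [seq row r B | r <- enum 'I_d].
  have [B Bu [t et]] := free_extend_unitmx (fP _ (enum_valP k)).
  by exists B; rewrite Bu et prefix_prefix.
pose B k := xchoose (ext k).
have BP k : (B k \in unitmx) && prefix (pts V (enum_val (A := P) k))
    [seq row r (B k) | r <- enum 'I_d] := xchooseP (ext k).
have [|T Tu TH] := isotropic_position (B := B).
  by move=> k; case/andP: (BP k).
exists T => // e; rewrite big_enum_val -[X in 4 * X%:R]card_ord.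
apply: le_trans (TH e); apply: ler_sum => k _.
rewrite -[X in X <= _]big_enum /=.
rewrite -(big_map V predT (fun v => cos2 (v *m T) e)) -/(pts V _).
rewrite -[X in _ <= X]big_enum /=.
rewrite -(big_map (fun r => row r (B k)) predT (fun v => cos2 (v *m T) e)).
case/andP: (BP k) => _ /prefixP[t ->]; rewrite big_cat /= lerDl.
by apply: sumr_ge0 => v _; apply: cos2_ge0.
Qed.

Section AffineHull.
Context {K : fieldType} {d : nat}.
Implicit Types (p x : 'rV[K]_d) (U : {vspace 'rV[K]_d}).
Local Open Scope classical_set_scope.

Lemma flat_rebase p q U : flat p U q -> flat p U = flat q U.
Proof.
rewrite /flat /= => qU; apply/seteqP; split => x /= xU.
  by rewrite -(subrK p x) -addrA -(opprB q p) rpredB.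
by rewrite -(subrK q x) -addrA rpredD.
Qed.

(** The hull is directed by the differences from one base point, and these lie in the linear
    span. *)
Lemma affine_hull_dim_le m (V : 'I_m -> 'rV[K]_d) (J : {set 'I_m}) :
  exists2 n : int, has_sublist_dim V J n & n <= (\dim <<pts V J>>)%:Z.
Proof.
have [->|[i0 i0J]] := set_0Vmem J.
  exists (-1) => //; left; split=> //.
  apply/seteqP; split => x //; apply: smallest_sub; first by left.
  by move=> y /= [j]; rewrite inE.
pose U := <<[seq V i - V i0 | i <- enum J]>>%VS.
exists (\dim U)%:Z; last first.
  rewrite lez_nat dimvS //; apply/span_subvP => _ /mapP[i iJ ->].
  by rewrite rpredB // memv_span // map_f // mem_enum.
right; exists (V i0), U; split=> //; apply/seteqP; split.
  apply: smallest_sub; first by right; exists (V i0), U.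
  move=> _ [i iJ ->]; rewrite /flat /=; apply/memv_span.
  by apply: (map_f (fun i => V i - V i0)); rewrite mem_enum.
move=> x xU S [] /= [->|[p [W ->]]] sub; first by case: (sub (V i0)); exists i0.
have /flat_rebase -> : flat p W (V i0) by apply: sub; exists i0.
have UW : (U <= W)%VS.
  apply/span_subvP => _ /mapP[i iJ ->]; rewrite mem_enum in iJ.
  have p0 : flat p W (V i0) by apply: sub; exists i0.
  have pi : flat p W (V i) by apply: sub; exists i.
  by move: pi; rewrite (flat_rebase p0).
exact: subvP UW _ xU.
Qed.

Lemma collinear_vline x y z : collinear x y z -> x != y ->
  z - x \in <[y - x]>%VS.
Proof.
move=> [p [U [dU xU yU zU]]] xy; rewrite (flat_rebase xU) /flat /= in yU zU.
suff -> : <[y - x]>%VS = U by [].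
apply/eqP; rewrite eqEdim -memvE yU dU dim_vline subr_eq0 eq_sym xy.
by [].
Qed.

End AffineHull.

(** * The dimension bound *)

Lemma triple_cos2 (R : realType) d (I : finType) (V : I -> 'rV[R[i]]_d) C
    (T : 'M[R[i]]_d) a b c :
  T \in unitmx -> (forall i, V i != 0) -> triple V C a b c ->
  1 / 2 <= cos2 (V a *m T) (V b *m T) + cos2 (V a *m T) (V c *m T)
           + cos2 (V b *m T) (V c *m T).
Proof.
move=> Tu V0 /and5P[_ _ _ _ /andP[_]]; rewrite inE => /andP[_ /vlineP[k Ek]].
have VT0 e : V e *m T != 0.
  apply: contra (V0 e) => /eqP e0.
  by rewrite -(mulmx1 (V e)) -(mulmxV Tu) mulmxA e0 mul0mx.
(* The relation is the affine one, [V c] being [(1 - k) *: V a + k *: V b], carried over by [T]. *)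
apply: (@cos2_dependent _ _ _ _ _ (1 - k) k (-1)) => //; last first.
  by rewrite oppr_eq0 oner_eq0 !andbF.
rewrite !scalemxAl -!mulmxDl (_ : _ + _ + _ = 0) ?mul0mx //.
by rewrite -[V c](subrK (V a)) Ek; apply/rowP => j; rewrite !mxE; ring.
Qed.

(** If some index of [C] has more than [s] lighter ones, choose such an index of least multiplicity:
    everything lighter than it lies in the set to be counted. *)
Lemma light_points_many (I : finType) (K : fieldType) (vT : vectType K)
    (V : I -> vT) (C : {set I}) (R : realFieldType) (s : R) : s <= #|C|%:R ->
  s <= #|[set a in C | #|lighter V C a|%:R <= s]|%:R.
Proof.
move=> sC; set L := [set a in _ | _].
have [LC|CL] := boolP (C \subset L).
  by rewrite (le_trans sC) // ler_nat subset_leq_card.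
have /subsetPn[a0 a0C a0L] := CL.
pose heavy a := (a \in C) && (a \notin L).
have Pa0 : heavy a0 by rewrite /heavy a0C.
case: (arg_minnP (fun a => #|same V C a|) Pa0) => a /andP[aC aL] amin.
have : ~~ (#|lighter V C a|%:R <= s) by move: aL; rewrite inE aC.
rewrite -ltNge => /ltW/le_trans; apply; rewrite ler_nat subset_leq_card //.
apply/subsetP => b; rewrite inE => /andP[bC ba].
by apply: contraLR ba => bL; rewrite -leqNgt amin // /heavy bC.
Qed.

Lemma LCC_large_low_rank (R : realType) (delta : R) d m
    (V : 'I_m -> 'rV[R[i]]_d) D : 0 < delta <= 1 -> (0 < m)%N ->
  is_LCC delta V -> (1 < D)%N -> 1536 < delta ^+ 2 * D%:R ->
  exists2 J : {set 'I_m}, delta * m%:R / 4 <= #|J|%:R &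
    (\dim <<pts V J>> < D)%N.
Proof.
move=> /andP[d0 d1] m0 [V0 lcc] D1 D_big.
have [//|noJ] := boolP [exists J : {set 'I_m},
    (delta * m%:R / 4 <= #|J|%:R) && (\dim <<pts V J>> < D)%N].
  by case/existsP=> J /andP[]; exists J.
have small (J : {set 'I_m}) : (\dim <<pts V J>> < D)%N -> #|J|%:R < delta * m%:R / 4.
  move=> JD; rewrite ltNge; apply: contra noJ => JB.
  by apply/existsP; exists J; rewrite JB.
have [P [tP PH PD]] := exists_free_packing V (ltnW D1).
pose C := cover P; have Csmall := small _ PD.
have dm0 : 0 < delta * m%:R by rewrite mulr_gt0 // ltr0n.
have dm1 : delta * m%:R <= m%:R by rewrite ler_piMl.
have mC : m%:R = #|C|%:R + #|~: C|%:R :> R by rewrite -natrD cardsC card_ord.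
have PC : #|C| = (#|P| * D)%N.
  rewrite -sum1_card big_trivIset //= -sum_nat_const; apply: eq_bigr => A AP.
  by rewrite sum1_card (PH _ AP).1.
have [|T Tu TH] := @packing_position _ _ _ V P.
  by move=> A /PH[].
pose g a b := cos2 (V a *m T) (V b *m T).
have g_ge0 a b : 0 <= g a b by apply: cos2_ge0.
pose E := \sum_(a in C) \sum_(b in C) g a b.
have E_le : E <= 4 * #|P|%:R * #|C|%:R.
  rewrite /E exchange_big /= mulr_natr -sumr_const; apply: ler_sum => b _.
  by rewrite big_trivIset //; apply: TH.
(* Copies of one point span dimension at most 1, which is below [D]. *)
have same_small a : #|same V C a|%:R < delta * m%:R / 4.
  apply: le_lt_trans (small [set b | V b == V a] _).
    by rewrite ler_nat; apply/subset_leq_card/subsetP => b; rewrite !inE => /andP[].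
  apply: leq_ltn_trans D1; apply: leq_trans (_ : \dim <[V a]> <= _)%N.
    apply/dimvS/span_subvP => _ /mapP[b + ->].
    by rewrite mem_enum inE => /eqP ->; apply: memv_line.
  by rewrite dim_vline; case: (_ != _).
pose Lt := [set a in C | #|lighter V C a|%:R <= delta * m%:R / 4].
have Lt_large : delta * m%:R / 4 <= #|Lt|%:R by apply: light_points_many; lra.
(* Of the allowance [delta * m], the uncovered indices, the copies of [a] and the lighter indices
   take at most a quarter each. *)
have rich_big a : a \in Lt -> delta * m%:R / 4 <= #|rich V C a|%:R.
  rewrite inE => /andP[aC a_light].
  have := @rich_large _ _ _ V C R a (delta * m%:R - #|~: C|%:R) aC.
  rewrite !natrD => h; suff : delta * m%:R - #|~: C|%:R <
      #|same V C a|%:R + #|lighter V C a|%:R + #|rich V C a|%:R.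
    by have := same_small a; move: a_light Csmall; rewrite -/C; lra.
  apply: h => {}h; move=> hD.
  have [|b [c [bD cD bc]]] := lcc (~: C :|: h) _ a.
    apply: le_trans (_ : (#|~: C| + #|h|)%:R <= _); last by rewrite natrD; lra.
    by rewrite ler_nat leq_card_setU.
  move: bD cD; rewrite !inE !negb_or !negbK => /andP[bC bD] /andP[cC cD].
  exists b, c; split=> //; case: bc => [|[ab ac bc col]]; [by left | right].
  by rewrite /triple aC bC ab ac bc inE cC; apply: collinear_vline.
have lower : #|Lt|%:R * (delta * m%:R / 4 / 4) <=
    \sum_a \sum_b \sum_(c | triple V C a b c) lweight V C a b :> R.
  rewrite mulr_natl -sumr_const [X in X <= _]big_mkcond; apply: ler_sum => a _.
  case: ifP => aL; last first.
    by apply: sumr_ge0 => b _; rewrite sumr_ge0 // => *; rewrite invr_ge0.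
  have aC : a \in C by move: aL; rewrite inE => /andP[].
  apply: le_trans (rich_weight_ge V R aC).
  have := rich_big _ aL; lra.
have upper := triple_energy_le V C g_ge0.
(* The 6 is the 3 of [triple_energy_le] divided by the 1/2 that each triple contributes at least. *)
have S_le : \sum_a \sum_b \sum_(c | triple V C a b c) lweight V C a b <= 6 * E.
  have -> : 6 * E = 2 * (3 * E) by ring.
  rewrite -ler_pdivrMl //; apply: le_trans upper.
  rewrite mulr_sumr; apply: ler_sum => a _.
  rewrite mulr_sumr; apply: ler_sum => b _.
  rewrite mulr_sumr; apply: ler_sum => c t.
  have w0 : 0 <= lweight V C a b :> R by rewrite invr_ge0.
  have := triple_cos2 Tu V0 t => h.
  by rewrite mulrC ler_wpM2l //; move: h; rewrite /g; lra.
have h1 : (delta * m%:R / 4) * (delta * m%:R / 4 / 4) <= 24 * #|P|%:R * #|C|%:R.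
  apply: le_trans (_ : #|Lt|%:R * (delta * m%:R / 4 / 4) <= _).
    by rewrite ler_wpM2r //; lra.
  by move: lower S_le E_le; lra.
(* Multiplying by [D] turns [#|P|] into [#|C|], which is at most [m]. Clearing the denominator 64 on
   the left then gives 64 * 24 = 1536. *)
have h2 : (delta * m%:R / 4) * (delta * m%:R / 4 / 4) * D%:R <= 24 * m%:R ^+ 2.
  apply: le_trans (_ : 24 * #|P|%:R * #|C|%:R * D%:R <= _).
    by rewrite ler_wpM2r.
  have -> : 24 * #|P|%:R * #|C|%:R * D%:R = 24 * #|C|%:R ^+ 2 :> R.
    by rewrite PC natrM; ring.
  by rewrite ler_pM2l // lerXn2r ?nnegrE ?ler0n // mC lerDl ler0n.
have mm0 : 0 < m%:R ^+ 2 :> R by rewrite exprn_gt0 // ltr0n.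
have : m%:R ^+ 2 * (delta ^+ 2 * D%:R) <= m%:R ^+ 2 * 1536 by move: h2; lra.
by rewrite ler_pM2l //; lra.
Qed.

Theorem theorem7p7 (R : realType) :
  exists K1 : nat, (0 < K1)%N /\
  forall delta : R, 0 < delta <= 1 ->
  forall (d m : nat) (V : 'I_m -> 'rV[R[i]]_d), is_LCC delta V ->
  exists (J : {set 'I_m}) (n : int),
    [/\ delta ^+ 3 * m%:R / K1%:R <= #|J|%:R,
        has_sublist_dim V J n &
        n%:~R <= K1%:R / delta ^+ 6].
Proof.
(* Any large constant works: truncating [B] to [D] lowers [delta ^+ 2 * B], which is at least 4000,
   by less than 1, so 1536 is exceeded comfortably. *)
exists 4000; split=> // delta delta01 d m V lcc.
have /andP[d0 d1] := delta01; set B := 4000 / _.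
have d2_0 : 0 < delta ^+ 2 by rewrite exprn_gt0.
have d6_0 : 0 < delta ^+ 6 by rewrite exprn_gt0.
have d6_2 : delta ^+ 6 <= delta ^+ 2 by rewrite ler_wiXn2l // ltW.
have d2_1 : delta ^+ 2 <= 1 by rewrite exprn_ile1 // ltW.
have BE : 4000 <= delta ^+ 2 * B.
  by rewrite mulrA ler_pdivlMr // mulrC ler_pM2r.
have B0 : 0 <= B by rewrite divr_ge0 // ltW.
pose D := Num.truncn B.
have DB : D%:R <= B by rewrite Num.Theory.truncn_le.
have BD : B < D%:R + 1 by rewrite natr1 Num.Theory.truncnS_gt.
have D_big : 1536 < delta ^+ 2 * D%:R.
  have : delta ^+ 2 * B < delta ^+ 2 * (D%:R + 1) by rewrite ltr_pM2l.
  lra.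
have D1 : (1 < D)%N.
  rewrite -(ltr_nat R); have : delta ^+ 2 * D%:R <= D%:R by rewrite ler_piMl.
  lra.
have finish (J : {set 'I_m}) : delta ^+ 3 * m%:R / 4000 <= #|J|%:R ->
    (\dim <<pts V J>> < D)%N -> exists (J : {set 'I_m}) (n : int),
    [/\ delta ^+ 3 * m%:R / 4000 <= #|J|%:R, has_sublist_dim V J n & n%:~R <= B].
  move=> JB JD; have [n hn nJ] := affine_hull_dim_le V J.
  exists J, n; split=> //; apply: le_trans DB; rewrite -[D%:R]/(D%:~R) ler_int.
  by apply: le_trans nJ _; rewrite lez_nat ltnW.
have [m0|m0] := posnP m.
  apply: (finish set0); first by rewrite m0 mulr0 mul0r.
  by rewrite /pts enum_set0 span_nil dimv0 ltnW.
have [J JB JD] := LCC_large_low_rank delta01 m0 lcc D1 D_big.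
apply: finish JD; apply: le_trans JB.
(* The sublist found has size at least [delta * m / 4]; as [delta <= 1], the cubic bound follows. *)
have d3 : delta ^+ 3 <= delta by rewrite -[X in _ <= X]expr1 ler_wiXn2l ?(ltW d0).
have : delta ^+ 3 * m%:R <= delta * m%:R by rewrite ler_wpM2r.
have : 0 <= delta * m%:R by rewrite mulr_ge0 // ltW.
lra.
Qed.
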